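(* For every tree $t$ on $n$ vertices with vertex degrees $k_1,\dots,k_n$, $$D_{min}^t \ge D_0^t = \frac{1}{4}\left(\frac{n}{2}\langle k^2\rangle + 2(n-1) + \frac{1}{2}q\right),$$ where $\langle k^2\rangle = \frac{1}{n}\sum_{i=1}^n k_i^2$ and $q=\sum_{i=1}^n (k_i \bmod 2)$ is the number of vertices of odd degree.
   Context: A linear arrangement of a graph on $n$ vertices is a bijection $\pi$ from its vertex set to $\{1,\dots,n\}$; the sum of edge lengths is $D(\pi)=\sum_{\{u,v\}\in E}|\pi(u)-\pi(v)|$, and $D_{min}^t$ is the minimum of $D(\pi)$ over all linear arrangements of the tree $t$. *)

(* Defs.v *)
From mathcomp Require Import all_boot all_order all_algebra.

Set Implicit Arguments.
Unset Strict Implicit.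
Unset Printing Implicit Defensive.

Import Order.TTheory GRing.Theory Num.Theory.

Section Graphs.
Variable T : finType.

Definition simple_graph (e : rel T) : Prop := symmetric e /\ irreflexive e.

(* A graph cycle has at least three vertices; ucycle also accepts [:: x; y]
   when x and y are adjacent. *)
Definition acyclic (e : rel T) : Prop := forall c : seq T, ucycle e c -> size c <= 2.

Definition connected_graph (e : rel T) : Prop :=
  0 < #|T| /\ forall x y : T, connect e x y.

Definition is_tree (e : rel T) : Prop :=
  [/\ simple_graph e, connected_graph e & acyclic e].

Definition degree (e : rel T) (v : T) : nat := #|[set w | e v w]|.

(* Each edge {u, v} is listed once, its endpoints ordered by the enumeration
   of T. *)
Definition edges (e : rel T) : {set T * T} :=
  [set p | e p.1 p.2 & enum_rank p.1 < enum_rank p.2].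

Definition linear_arrangement (pi : {ffun T -> 'I_#|T|}) : bool :=
  injectiveb pi && [forall i, exists v, pi v == i].

(* 'I_n is {0, ..., n-1}, whence the successor. *)
Definition position (pi : {ffun T -> 'I_#|T|}) (v : T) : nat := (pi v).+1.

Definition sum_edge_lengths (e : rel T) (pi : {ffun T -> 'I_#|T|}) : nat :=
  \sum_(p in edges e) `|position pi p.1 - position pi p.2|%N.

Definition enum_arrangement : {ffun T -> 'I_#|T|} := [ffun v => enum_rank v].

(* enum_arrangement only witnesses that the set of arrangements is nonempty. *)
Definition Dmin (e : rel T) : nat :=
  sum_edge_lengths e
    [arg min_(pi < enum_arrangement | linear_arrangement pi)
       sum_edge_lengths e pi].

Lemma linear_arrangementP (pi : {ffun T -> 'I_#|T|}) :
  reflect (bijective pi) (linear_arrangement pi).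
Proof.
apply: (iffP andP) => [[/injectiveP inj_pi _] | [g piK gK]].
  by apply: inj_card_bij; rewrite ?card_ord.
split; first by apply/injectiveP; apply: can_inj piK.
by apply/forallP => i; apply/existsP; exists (g i); rewrite gK.
Qed.

Lemma enum_arrangementP : linear_arrangement enum_arrangement.
Proof.
apply/linear_arrangementP; exists enum_val => v.
  by rewrite ffunE enum_rankK.
by rewrite ffunE enum_valK.
Qed.

Lemma Dmin_attained (e : rel T) :
  exists2 pi, linear_arrangement pi & Dmin e = sum_edge_lengths e pi.
Proof.
rewrite /Dmin; case: arg_minnP => [|pi la_pi _]; first exact: enum_arrangementP.
by exists pi.
Qed.

Lemma Dmin_le (e : rel T) (pi : {ffun T -> 'I_#|T|}) :
  linear_arrangement pi -> Dmin e <= sum_edge_lengths e pi.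
Proof.
rewrite /Dmin; case: arg_minnP => [|pi0 _ min_pi0]; first exact: enum_arrangementP.
exact: min_pi0.
Qed.

Definition odd_degree_count (e : rel T) : nat := \sum_(v : T) degree e v %% 2.

Local Open Scope ring_scope.

Definition mean_sq_degree (e : rel T) : rat :=
  #|T|%:R^-1 * \sum_(v : T) (degree e v)%:R ^+ 2.

Definition D0 (e : rel T) : rat :=
  let n : rat := #|T|%:R in
  1 / 4 * (n / 2 * mean_sq_degree e + 2 * (n - 1)
           + 1 / 2 * (odd_degree_count e)%:R).

End Graphs.

(* Main.v *)
Require Import Defs.
From mathcomp Require Import all_boot all_order all_algebra.
From mathcomp Require Import zify ring lra.

(** Summing the edge lengths around each vertex counts every edge twice. Around
    a vertex of degree [k] the neighbours occupy [k] distinct positions, at most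
    two of them at each distance, so the local sum is at least
    1 + 1 + 2 + 2 + ... ([k] terms), which is (k^2 + 2k + (k mod 2)) / 4.
    Summing over the vertices gives the bound, since a connected graph has
    degree sum at least 2(n - 1). *)

Import Order.TTheory GRing.Theory Num.Theory.
Local Open Scope ring_scope.

Section DistanceSums.
Set Implicit Arguments.
Unset Strict Implicit.
Local Open Scope nat_scope.
Variables (T : finType) (f : T -> nat) (v : T).
Hypothesis f_inj : injective f.
Implicit Type A : {set T}.

(** Translating by [d - f v] places the values of [f] on [v |: A] injectively among the [2d + 1]
    numbers from 0 to [2d], and [v] itself takes one of them. *)
Lemma card_within_distance A d :
    v \notin A -> {in A, forall w, `|f v - f w| <= d} ->
  #|A| <= d.*2.
Proof.
(* On [v |: A] the subtraction does not truncate and [inord] stays in range, since [f w] lies within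
   [d] of [f v]. *)
move=> vA le_d; pose g w : 'I_d.*2.+1 := inord (f w + d - f v).
have le_dU w : w \in v |: A -> `|f v - f w| <= d.
  by rewrite !inE => /predU1P[->|/le_d //]; rewrite distnn.
have g_inj : {in v |: A &, injective g}.
  move=> x y /le_dU dx /le_dU dy /(congr1 val) /=.
  by rewrite !inordK; [move=> eq_xy; apply: f_inj; lia | lia | lia].
have := max_card (mem [set g w | w in v |: A]).
by rewrite card_in_imset // cardsU1 vA card_ord add1n ltnS.
Qed.

(** Induction on [#|A|], removing an element [w] farthest from [v]. If its distance is [d], then
    [k + 1 <= 2d], while passing from [k] to [k + 1] raises the left side by exactly 4 times the
    ceiling of [(k + 1) / 2], hence by at most [4d]. *)
Lemma sum_distances_ge A :
    v \notin A ->
  #|A| ^ 2 + 2 * #|A| + #|A| %% 2 <= 4 * \sum_(w in A) `|f v - f w|.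
Proof.
move Dk: #|A| => k; elim: k A Dk => [|k IHk] A Dk vA; first by [].
have [w0 w0A] : exists w, w \in A by apply/card_gt0P; rewrite Dk.
case: (@arg_maxnP _ w0 (mem A) (fun w => `|f v - f w|) w0A) => w /= wA max_w.
have := card_within_distance vA max_w.
have DkD : #|A :\ w| = k by move: (cardsD1 w A); rewrite wA Dk => -[].
have vAD : v \notin A :\ w by rewrite !inE negb_and vA orbT.
by rewrite (big_setD1 w) //= Dk; have := IHk _ DkD vAD; nia.
Qed.

End DistanceSums.

Section DegreeSums.
Set Implicit Arguments.
Unset Strict Implicit.
Local Open Scope nat_scope.
Variables (T : finType) (e : rel T).

Lemma sum_edgesE (F : T -> T -> nat) :
    symmetric e -> irreflexive e -> (forall x y, F x y = F y x) ->
  \sum_v \sum_(w in [set w | e v w]) F v w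
    = 2 * \sum_(p in edges e) F p.1 p.2.
Proof.
move=> e_sym e_irr F_sym; rewrite pair_big_dep /=.
rewrite (bigID (fun p => enum_rank p.1 < enum_rank p.2)) /= mul2n -addnn.
congr (_ + _); first by apply: eq_bigl => p; rewrite !inE.
(* Swapping the endpoints turns the pairs of decreasing rank into those listed in [edges e];
   irreflexivity excludes the diagonal. *)
have swapK : involutive (fun p : T * T => (p.2, p.1)) by case.
rewrite (reindex_inj (inv_inj swapK)) /=.
rewrite (eq_bigl (mem (edges e))) => [|[x y]]; first by apply: eq_bigr.
rewrite !inE /= e_sym -leqNgt leq_eqVlt.
case: (eqVneq x y) => [->|ne_xy]; first by rewrite e_irr.
by rewrite (inj_eq val_inj) (inj_eq enum_rank_inj) (negPf ne_xy).
Qed.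

(** Otherwise [S] would be closed under [e] and contain everything connected to [x]. *)
Lemma edge_out_of (S : {set T}) x y :
    symmetric e -> connect e x y -> x \in S -> y \notin S ->
  exists u v, [/\ u \in S, v \notin S & e u v].
Proof.
move=> e_sym xy xS yS.
have [/existsP[u /existsP[v /and3P[uS vS uv]]]|no_uv] :=
  boolP [exists u, exists v, [&& u \in S, v \notin S & e u v]].
  by exists u, v.
have closedS : closed e (mem S).
  apply: intro_closed => [|u v uv uS].
    by apply: sym_connect_sym.
  apply: contraNT no_uv => vS.
  by apply/existsP; exists u; apply/existsP; exists v; apply/and3P.
by move: yS; rewrite -[y \in S](closed_connect closedS xy) xS.
Qed.

(** [S] grows one vertex at a time along an edge leaving it; each new vertex [v], reached from [u],
    brings the two new arcs [(u, v)] and [(v, u)]. *)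
Lemma connected_subset_arcs k :
    symmetric e -> connected_graph e -> k < #|T| ->
  exists S : {set T}, #|S| = k.+1 /\
    2 * k <= #|[set p : T * T | [&& p.1 \in S, p.2 \in S & e p.1 p.2]]|.
Proof.
move=> e_sym [/card_gt0P[x0 _] conn].
elim: k => [_|k IHk ltkn]; first by exists [set x0]; rewrite cards1.
have [S [cardS arcsS]] := IHk (ltnW ltkn).
have [x xS] : exists x, x \in S by apply/card_gt0P; rewrite cardS.
have [y yS] : exists y, y \notin S.
  have /card_gt0P[y] : 0 < #|~: S| by have := cardsC S; lia.
  by rewrite inE; exists y.
have [u [v [uS vS uv]]] := edge_out_of e_sym (conn x y) xS yS.
exists (v |: S); split; first by rewrite cardsU1 vS cardS.
set arcs := [set p | _] in arcsS *.
have ne_uv : u != v by apply: contraNneq vS => <-.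
have uvA : (u, v) \notin (v, u) |: arcs.
  by rewrite !inE /= xpair_eqE (negPf ne_uv) (negPf vS) andbF.
have vuA : (v, u) \notin arcs by rewrite inE /= (negPf vS).
apply: (@leq_trans #|(u, v) |: ((v, u) |: arcs)|).
  by rewrite cardsU1 uvA cardsU1 vuA; lia.
apply/subset_leq_card/subsetP => -[a b]; rewrite !inE /= !xpair_eqE.
case/or3P=> [/andP[/eqP-> /eqP->]|/andP[/eqP-> /eqP->]|/and3P[-> -> ->]].
- by rewrite uS eqxx uv orbT.
- by rewrite uS eqxx e_sym uv orbT.
- by rewrite !orbT.
Qed.

Lemma sum_degree_connected :
  symmetric e -> connected_graph e -> 2 * #|T|.-1 <= \sum_v degree e v.
Proof.
move=> e_sym conn; have [T_gt0 _] := conn.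
have [|S [_ arcsS]] := @connected_subset_arcs #|T|.-1 e_sym conn.
  by rewrite prednK.
apply: leq_trans arcsS _.
rewrite (eq_bigr (fun v => \sum_(w | e v w) 1)) => [|v _]; last first.
  by rewrite /degree -sum1_card; apply: eq_bigl => w; rewrite inE.
rewrite pair_big_dep /= sum1_card.
by apply/subset_leq_card/subsetP => p; rewrite !inE => /and3P[].
Qed.

Lemma sum_edge_lengths_ge (pi : {ffun T -> 'I_#|T|}) :
    simple_graph e -> linear_arrangement pi ->
  \sum_v (degree e v ^ 2 + 2 * degree e v + degree e v %% 2)
    <= 8 * sum_edge_lengths e pi.
Proof.
move=> [e_sym e_irr] /linear_arrangementP/bij_inj pi_inj.
have pos_inj : injective (position pi).
  by move=> x y [/val_inj/pi_inj].
(* The 4 comes from the local bound [sum_distances_ge], the 2 from counting each edge at both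
   ends. *)
rewrite -[8]/(4 * 2) -mulnA.
rewrite -(sum_edgesE (F := fun x y => `|position pi x - position pi y|)) //.
  rewrite big_distrr /=; apply: leq_sum => v _.
  by apply: sum_distances_ge; rewrite // inE e_irr.
by move=> x y; rewrite distnC.
Qed.

End DegreeSums.

Theorem theorem2 (T : finType) (e : rel T) (ht : is_tree e) :
  D0 e <= (Dmin e)%:R.
Proof.
have [simple_e conn_e _] := ht; have [T_gt0 _] := conn_e.
have [pi la_pi ->] := Dmin_attained e.
have deg_ge := sum_degree_connected simple_e.1 conn_e.
have := sum_edge_lengths_ge simple_e la_pi.
rewrite /D0 /mean_sq_degree /odd_degree_count 2!big_split /=.
rewrite -[X in (_ + X + _ <= _)%N]big_distrr /=.
have -> : \sum_v (degree e v)%:R ^+ 2 = (\sum_v degree e v ^ 2)%:R :> rat.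
  by rewrite natr_sum; apply: eq_bigr => v _; rewrite natrX.
have n_neq0 : #|T|%:R != 0 :> rat by rewrite pnatr_eq0 -lt0n.
set s1 := (\sum_v degree e v)%N in deg_ge *; set s2 := (\sum_v _ ^ 2)%N.
set q := (\sum_v _ %% 2)%N; set L := sum_edge_lengths _ _ => L_ge.
(* This is the claim multiplied by 8; the term [2 * s1] is bounded below by [4 * (#|T| - 1)]. *)
have : (s2 + 4 * (#|T| - 1) + q <= 8 * L)%N by lia.
rewrite -(ler_nat rat) 2!natrD 2!natrM natrB //.
have -> : #|T|%:R / 2 * (#|T|%:R^-1 * s2%:R) = s2%:R / 2 :> rat by field.
by lra.
Qed.
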